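(* Let $\mathcal{H}$ be a separable complex Hilbert space. Let $A$, $B$ and $C$ be bounded self-adjoint operators on $\mathcal{H}$. If $$\cosh(A)\, e^B = e^B \cosh(A),$$ $$\sinh(A)\, e^C = e^B \sinh(A),$$ $$e^C \cosh(A) = \cosh(A)\, e^C,$$ $$e^C \sinh(A) = \sinh(A)\, e^B,$$ then $AC = BA$.
   Context: For a bounded operator $T$ on a complex Hilbert space, $e^T=\sum_{n\ge 0} T^n/n!$, $\cosh(T) = \sum_{n\ge 0} T^{2n}/(2n)!$ and $\sinh(T) = \sum_{n\ge 0} T^{2n+1}/(2n+1)!$, with convergence in operator norm. *)

(* Defs.v *)
From HB Require Import structures.
From mathcomp Require Import all_boot all_order all_algebra.
From mathcomp Require Import all_classical all_reals all_analysis.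
From mathcomp Require Import complex.

Set Implicit Arguments.
Unset Strict Implicit.
Unset Printing Implicit Defensive.

Import Order.TTheory GRing.Theory Num.Theory.
Import numFieldNormedType.Exports.

Local Open Scope classical_set_scope.
Local Open Scope ring_scope.
Local Open Scope complex_scope.

(* [{dot H for conj}] is a positive definite Hermitian form, linear in its
   first argument; [innerE] says that it induces the norm of [H]. *)
HB.mixin Record isHilbert (R : realType) H of CompleteNormedModule R[i] H := {
  inner : {dot H for (@Num.conj R[i])} ;
  innerE : forall x : H, inner x x = `|x| ^+ 2
}.

#[short(type="hilbertType")]
HB.structure Definition Hilbert (R : realType) :=
  {H of CompleteNormedModule R[i] H & isHilbert R H}.

Definition separable (T : topologicalType) :=
  exists S : set T, countable S /\ dense S.

Section BoundedOp.
Context {R : realType} {H : hilbertType R}.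

Definition bounded_linear (T : H -> H) : Prop :=
  linear T /\ exists M : R, forall x, `|T x| <= M%:C * `|x|.

Definition bounded_linear_pred : {pred H -> H} :=
  fun T => `[< bounded_linear T >].

End BoundedOp.

Record boundedOp (R : realType) (H : hilbertType R) := BoundedOp {
  op_fun :> H -> H ;
  op_funP : op_fun \in bounded_linear_pred }.

HB.instance Definition _ (R : realType) (H : hilbertType R) :=
  [isSub for @op_fun R H].
HB.instance Definition _ (R : realType) (H : hilbertType R) :=
  [Choice of boundedOp H by <:].

Section BoundedOpTheory.
Context {R : realType} {H : hilbertType R}.
Implicit Types (x y : H) (S T : boundedOp H).

(* The library norm of [H] takes its (nonnegative real) values in [R[i]]. *)
Definition rnorm x : R := complex.Re `|x|.

Lemma rnormE x : `|x| = (rnorm x)%:C.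
Proof. by rewrite /rnorm RRe_real ?normr_real. Qed.

Lemma rnorm_ge0 x : 0 <= rnorm x.
Proof. by rewrite -lecR -rnormE normr_ge0. Qed.

Lemma rnormD x y : rnorm (x + y) <= rnorm x + rnorm y.
Proof. by rewrite -lecR rmorphD/= -!rnormE ler_normD. Qed.

Lemma rnormZ (a : R[i]) x : rnorm (a *: x) = Normc.normc a * rnorm x.
Proof.
by apply: complexI; rewrite rmorphM -!rnormE normrZ rnormE.
Qed.

Lemma rnorm0 : rnorm 0 = 0. Proof. by rewrite /rnorm normr0. Qed.

Lemma rnorm0_eq0 x : rnorm x = 0 -> x = 0.
Proof. by move=> x0; apply/normr0_eq0; rewrite rnormE x0. Qed.

Lemma bounded_linearP (T : H -> H) :
  bounded_linear T <->
  linear T /\ exists2 M : R, 0 <= M & forall x, rnorm (T x) <= M * rnorm x.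
Proof.
split=> -[lT [M]]; last first.
  by move=> _ hM; split=> //; exists M => x; rewrite !rnormE -rmorphM lecR.
move=> hM; split=> //; exists (Num.max M 0); first by rewrite le_max lexx orbT.
move=> x; rewrite (@le_trans _ _ (M * rnorm x))//; last first.
  by rewrite ler_wpM2r ?rnorm_ge0// le_max lexx.
by rewrite -lecR rmorphM/= -!rnormE.
Qed.

Lemma bounded_linear_submod : GRing.submod_closed (@bounded_linear_pred R H).
Proof.
split=> [|a f g /asboolP/bounded_linearP[lf [M M0 hM]]
              /asboolP/bounded_linearP[lg [N N0 hN]]].
  apply/asboolP/bounded_linearP; split=> [a x y|].
    by rewrite -[LHS]/(0 : H) -[RHS]/(a *: 0 + 0 : H) scaler0 addr0.
  by exists 0 => // x; rewrite mul0r rnorm0.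
apply/asboolP/bounded_linearP; split.
  move=> b x y; rewrite -[LHS]/(a *: f _ + g _) -[RHS]/(b *: (a *: f x + g x) + (a *: f y + g y)) lf lg.
  by rewrite !scalerDr !scalerA (mulrC a b) !addrA; congr (_ + _); rewrite addrAC.
have a0 : 0 <= Normc.normc a by rewrite -lecR (normr_ge0 a).
exists (Normc.normc a * M + N); first by rewrite addr_ge0 ?mulr_ge0.
move=> x; rewrite -[(a *: f + g) x]/(a *: f x + g x) (le_trans (rnormD _ _))// rnormZ mulrDl.
by rewrite lerD// -mulrA ler_wpM2l.
Qed.

HB.instance Definition _ :=
  GRing.isSubmodClosed.Build _ _ (@bounded_linear_pred R H) bounded_linear_submod.

End BoundedOpTheory.

HB.instance Definition _ (R : realType) (H : hilbertType R) :=
  [SubChoice_isSubLmodule of boundedOp H by <:].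

Section BoundedOpRing.
Context {R : realType} {H : hilbertType R}.
Implicit Types (x y : H) (S T : boundedOp H).

Lemma op_eqP S T : S = T <-> forall x, S x = T x.
Proof. by split=> [->//|ST]; apply/val_inj/funext. Qed.

Lemma op_addE S T x : (S + T) x = S x + T x. Proof. by []. Qed.
Lemma op_oppE S x : (- S) x = - S x. Proof. by []. Qed.
Lemma op_scaleE (a : R[i]) S x : (a *: S) x = a *: S x. Proof. by []. Qed.
Lemma op_zeroE x : (0 : boundedOp H) x = 0. Proof. by []. Qed.

Lemma op_bounded_linear T : bounded_linear T.
Proof. exact/asboolP/(op_funP T). Qed.

Lemma op_linear T : linear T. Proof. by case: (op_bounded_linear T). Qed.

Lemma op_bounded T : exists2 M : R, 0 <= M & forall x, rnorm (T x) <= M * rnorm x.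
Proof. by case: (proj1 (bounded_linearP T) (op_bounded_linear T)). Qed.

HB.instance Definition _ T := GRing.isLinear.Build R[i] H H *:%R T (op_linear T).

Lemma op_one_subproof : @idfun H \in bounded_linear_pred.
Proof.
apply/asboolP/bounded_linearP; split=> //.
by exists 1 => // x; rewrite mul1r.
Qed.

Definition op_one : boundedOp H := BoundedOp op_one_subproof.

Lemma op_mul_subproof S T : (S \o T : H -> H) \in bounded_linear_pred.
Proof.
apply/asboolP/bounded_linearP; split.
  by move=> a x y /=; rewrite !linearP.
have [M M0 hM] := op_bounded S; have [N N0 hN] := op_bounded T.
exists (M * N) => [|x /=]; first exact: mulr_ge0.
by rewrite (le_trans (hM _))// -mulrA ler_wpM2l.
Qed.

Definition op_mul S T : boundedOp H := BoundedOp (op_mul_subproof S T).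

Lemma op_mulA : associative op_mul. Proof. by move=> *; apply/op_eqP. Qed.
Lemma op_mul1 : left_id op_one op_mul. Proof. by move=> *; apply/op_eqP. Qed.
Lemma op_mulr1 : right_id op_one op_mul. Proof. by move=> *; apply/op_eqP. Qed.
Lemma op_mulDl : left_distributive op_mul +%R.
Proof. by move=> *; apply/op_eqP. Qed.
Lemma op_mulDr : right_distributive op_mul +%R.
Proof. by move=> S T U; apply/op_eqP => x; apply: linearD. Qed.

(* Only a [pzRingType]: the ring is trivial when [H] is. *)
HB.instance Definition _ := GRing.Zmodule_isPzRing.Build (boundedOp H)
  op_mulA op_mul1 op_mulr1 op_mulDl op_mulDr.

Definition opnorm T : R := sup [set rnorm (T x) | x in [set x | `|x| <= 1]].

Lemma unit_ballE x : (`|x| <= 1) = (rnorm x <= 1).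
Proof. by rewrite rnormE (lecR _ 1). Qed.

Lemma opnorm_has_sup T :
  has_sup [set rnorm (T x) | x in [set x | `|x| <= 1]].
Proof.
split; first by exists (rnorm (T 0)), 0 => //=; rewrite normr0.
have [M M0 hM] := op_bounded T; exists M => _ [x /= x1 <-].
by rewrite (le_trans (hM x))// ler_piMr// -unit_ballE.
Qed.

Lemma opnorm_ge0 T : 0 <= opnorm T.
Proof.
rewrite (@le_trans _ _ (rnorm (T 0))) ?rnorm_ge0//.
by apply: ub_le_sup; [case: (opnorm_has_sup T)|exists 0 => //=; rewrite normr0].
Qed.

Lemma opnormP T x : rnorm (T x) <= opnorm T * rnorm x.
Proof.
have [x0|x0] := eqVneq (rnorm x) 0.
  by rewrite x0 mulr0 (rnorm0_eq0 x0) linear0 rnorm0.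
have xp : 0 < rnorm x by rewrite lt_neqAle eq_sym x0 rnorm_ge0.
have nV : Normc.normc ((rnorm x)^-1)%:C = (rnorm x)^-1.
  by rewrite /= expr0n addr0 sqrtr_sqr ger0_norm ?invr_ge0 ?rnorm_ge0.
rewrite -ler_pdivrMr// mulrC -[X in X * _]nV -rnormZ -linearZ/=.
apply: ub_le_sup; first by case: (opnorm_has_sup T).
by exists (((rnorm x)^-1)%:C *: x); rewrite //= unit_ballE rnormZ nV mulVf.
Qed.

Lemma opnorm_le T (M : R) :
  0 <= M -> (forall x, rnorm (T x) <= M * rnorm x) -> opnorm T <= M.
Proof.
move=> M0 hM; apply: ge_sup; first by case: (opnorm_has_sup T).
move=> _ [x /= x1 <-]; rewrite (le_trans (hM x))// ler_piMr//.
by rewrite -unit_ballE.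
Qed.

Lemma opnormM S T : opnorm (S * T) <= opnorm S * opnorm T.
Proof.
apply: opnorm_le => [|x]; first by rewrite mulr_ge0 ?opnorm_ge0.
rewrite (le_trans (opnormP S (T x)))// -mulrA ler_wpM2l ?opnorm_ge0//.
exact: opnormP.
Qed.

Definition opnormC T : R[i] := (opnorm T)%:C.

Lemma opnormC_triangle S T : opnormC (S + T) <= opnormC S + opnormC T.
Proof.
rewrite -rmorphD/= lecR; apply: opnorm_le => [|x].
  by rewrite addr_ge0 ?opnorm_ge0.
by rewrite (le_trans (rnormD _ _))// mulrDl lerD ?opnormP.
Qed.

Lemma opnormCZ (a : R[i]) T : opnormC (a *: T) = `|a| * opnormC T.
Proof.
rewrite -[`|a|]/((Normc.normc a)%:C) -rmorphM/=; congr (_%:C).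
set b := Normc.normc a.
have b0 : 0 <= b by rewrite -lecR (normr_ge0 a).
apply/eqP; rewrite eq_le; apply/andP; split.
  apply: opnorm_le => [|x]; first by rewrite mulr_ge0 ?opnorm_ge0.
  by rewrite op_scaleE rnormZ -mulrA ler_wpM2l ?opnormP.
have [->|bn0] := eqVneq b 0; first by rewrite mul0r opnorm_ge0.
have bp : 0 < b by rewrite lt_neqAle eq_sym bn0.
rewrite mulrC -ler_pdivlMr//; apply: opnorm_le => [|x].
  by rewrite divr_ge0 ?opnorm_ge0.
rewrite mulrAC ler_pdivlMr// mulrC -rnormZ.
exact: (opnormP (a *: T)).
Qed.

Lemma opnormC_eq0 T : opnormC T = 0 -> T = 0.
Proof.
move=> /complexI T0; apply/op_eqP => x; apply: rnorm0_eq0; apply/eqP.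
by rewrite eq_le rnorm_ge0 (le_trans (opnormP T x))// T0 mul0r.
Qed.

HB.instance Definition _ := Lmodule_isNormed.Build R[i] (boundedOp H)
  opnormC_triangle opnormCZ opnormC_eq0.

Lemma op_normE T : `|T| = (opnorm T)%:C. Proof. by []. Qed.

End BoundedOpRing.

Section BoundedOpComplete.
Context {R : realType} {H : hilbertType R}.

Lemma boundedOp_complete (F : set_system (boundedOp H)) :
  ProperFilter F -> cauchy F -> cvg F.
Proof.
move=> FF /cauchy_ballP Fc.
have Fo (e : R) : 0 < e -> exists2 A : set (boundedOp H), F A &
    forall S T, A S -> A T -> opnorm (S - T) < e.
  move=> e0; have /Fc[[A B] [/= FA FB] AB] : 0 < e%:C :> R[i] by rewrite ltcR.
  exists (A `&` B) => [|S T [AS _] [_ BT]]; first exact: filterI.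
  by move: (AB (S, T) (conj AS BT)); rewrite -ball_normE /ball_ /= op_normE ltcR.
have posC (e : R[i]) : 0 < e -> exists2 r : R, 0 < r & r%:C = e.
  by case: e => a b; rewrite ltcE/= => /andP[/eqP-> a0]; exists a.
have Fx x : cvg ((fun T : boundedOp H => T x) @ F).
  apply: cauchy_cvg; apply/cauchy_ballP => e /posC[r r0 <-].
  have x1 : 0 < rnorm x + 1 by rewrite ltr_wpDl// rnorm_ge0.
  have [A FA AA] := Fo _ (divr_gt0 r0 x1).
  pose B : set H := [set (S : boundedOp H) x | S in A].
  exists (B, B).
    suff FB : F ((fun T : boundedOp H => T x) @^-1` B) by split.
    by apply: filterS FA => S AS; exists S.
  move=> [_ _] [/= [S AS <-] [T AT <-]].
  rewrite -ball_normE /ball_ /= rnormE ltcR.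
  rewrite (le_lt_trans (opnormP (S - T) x))//.
  rewrite (@le_lt_trans _ _ (r / (rnorm x + 1) * rnorm x))//.
    by rewrite ler_wpM2r ?rnorm_ge0// ltW// AA.
  by rewrite mulrAC ltr_pdivrMr// ltr_pM2l// ltrDl.
pose L x : H := lim ((fun T : boundedOp H => T x) @ F).
have Lx x : (fun T : boundedOp H => T x) @ F --> L x by exact: Fx.
have linL : linear L.
  move=> a x y; apply: cvg_lim => //.
  under eq_fun do rewrite linearP.
  by apply: cvgD; [apply: cvgZr|]; exact: Lx.
have near_L (A : set (boundedOp H)) (e : R) T : F A -> 0 < e ->
    (forall S, A S -> opnorm (T - S) < e) ->
  forall x, rnorm (T x - L x) <= e * rnorm x.
  move=> FA e0 AT x; apply/ler_addgt0Pr => d d0.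
  have dC : 0 < d%:C :> R[i] by rewrite ltcR.
  have FB : \forall S \near F, `|L x - (S : boundedOp H) x| < d%:C.
    by move/cvgrPdist_lt: (Lx x); apply.
  have [S [AS]] := @filter_ex _ F _ _ (@filterI _ F _ _ _ FA FB).
  rewrite /= rnormE ltcR => LS.
  rewrite -(subrKA (S x)) -(opprB (L x)).
  rewrite (le_trans (rnormD _ _))// lerD//.
    rewrite (le_trans (opnormP (T - S) x))// ler_wpM2r ?rnorm_ge0//.
    exact/ltW/AT.
  by rewrite /rnorm normrN ltW.
have bL : L \in bounded_linear_pred.
  apply/asboolP/bounded_linearP; split=> //.
  have [A FA AA] := Fo 1 ltr01.
  have [T AT] := @filter_ex _ F _ _ FA.
  exists (opnorm T + 1) => [|x]; first by rewrite addr_ge0 ?opnorm_ge0.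
  rewrite -[L x](subKr (T x)) (le_trans (rnormD _ _))// mulrDl lerD ?opnormP//.
  rewrite [leLHS]/rnorm normrN.
  by apply: near_L FA ltr01 _ _ => S AS; exact: AA.
apply/cvg_ex; exists (BoundedOp bL); apply/cvgrPdist_le => _ /posC[e e0 <-].
have [A FA AA] := Fo e e0; apply: filterS (FA) => T AT.
rewrite distrC op_normE lecR; apply: opnorm_le (ltW e0) _ => x.
by apply: near_L FA e0 _ _ => S AS; exact: AA.
Qed.

HB.instance Definition _ := Uniform_isComplete.Build (boundedOp H)
  boundedOp_complete.

End BoundedOpComplete.

Section OperatorFunctions.
Context {R : realType} {H : hilbertType R}.
Implicit Types T : boundedOp H.

Definition selfadjoint T : Prop :=
  forall x y : H, inner (T x) y = inner x (T y).

(* [limn] is taken in [boundedOp H], i.e. for the operator norm. *)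
Definition op_exp T : boundedOp H :=
  limn (series (fun n => n`!%:R^-1 *: T ^+ n)).

Definition op_cosh T : boundedOp H :=
  limn (series (fun n => (2 * n)`!%:R^-1 *: T ^+ (2 * n))).

Definition op_sinh T : boundedOp H :=
  limn (series (fun n => (2 * n).+1`!%:R^-1 *: T ^+ (2 * n).+1)).

Lemma op_series_cvg (u : nat -> boundedOp H) (v : nat -> R) :
  (forall n, opnorm (u n) <= v n) -> cvgn (series v) -> cvgn (series u).
Proof.
move=> uv /cauchy_cvgP/cauchy_seriesP v_cvg.
apply: cauchy_cvg; apply/cauchy_seriesP => e e0.
have [r r0 <-] : exists2 r : R, 0 < r & r%:C = e.
  by move: e0; case: e => a b; rewrite ltcE/= => /andP[/eqP-> a0]; exists a.
apply: filterS (v_cvg r r0) => n hn.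
rewrite (@le_lt_trans _ _ (\sum_(n.1 <= k < n.2) v k)%:C)//; last first.
  by rewrite ltcR (le_lt_trans _ hn)// ler_norm.
rewrite (le_trans (ler_norm_sum _ _ _))// rmorph_sum ler_sum// => k _.
by rewrite op_normE lecR.
Qed.

Lemma opnormX T n : opnorm (T ^+ n) <= opnorm T ^+ n.
Proof.
elim: n => [|n ih]; first by apply: opnorm_le => // x; rewrite mul1r.
by rewrite !exprS (le_trans (opnormM _ _))// ler_wpM2l ?opnorm_ge0.
Qed.

Lemma opnorm_coeff T m n :
  opnorm (m`!%:R^-1 *: T ^+ n) <= opnorm T ^+ n / m`!%:R.
Proof.
have : opnorm (m`!%:R^-1 *: T ^+ n) = m`!%:R^-1 * opnorm (T ^+ n).
  apply: complexI; rewrite -op_normE normrZ rmorphM/= fmorphV/= rmorph_nat.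
  by rewrite ger0_norm// invr_ge0.
by move=> ->; rewrite mulrC ler_wpM2r ?invr_ge0 ?opnormX.
Qed.

Lemma is_cvg_op_exp T : cvgn (series (fun n => n`!%:R^-1 *: T ^+ n)).
Proof.
apply: op_series_cvg (is_cvg_series_exp_coeff (opnorm T)) => n.
exact: opnorm_coeff.
Qed.

Lemma is_cvg_op_cosh T :
  cvgn (series (fun n => (2 * n)`!%:R^-1 *: T ^+ (2 * n))).
Proof.
apply: op_series_cvg (is_cvg_series_exp_coeff (opnorm T ^+ 2)) => n.
rewrite (le_trans (opnorm_coeff _ _ _))// exprM /exp_coeff/= ler_wpM2l//.
  by rewrite exprn_ge0// exprn_ge0// opnorm_ge0.
by rewrite lef_pV2 ?posrE ?ltr0n ?fact_gt0// ler_nat leq_fact// leq_pmull.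
Qed.

Lemma is_cvg_op_sinh T :
  cvgn (series (fun n => (2 * n).+1`!%:R^-1 *: T ^+ (2 * n).+1)).
Proof.
have := @is_cvg_seriesZ _ _ (opnorm T) (is_cvg_series_exp_coeff (opnorm T ^+ 2)).
apply: op_series_cvg => n.
rewrite (le_trans (opnorm_coeff _ _ _))// exprS exprM -mulrA.
rewrite ler_wpM2l ?opnorm_ge0// ler_wpM2l//.
  by rewrite exprn_ge0// exprn_ge0// opnorm_ge0.
rewrite lef_pV2 ?posrE ?ltr0n ?fact_gt0// ler_nat leq_fact//.
by rewrite (leq_trans (leq_pmull n _) (leqnSn _)).
Qed.

End OperatorFunctions.

(* Main.v *)
Require Import Defs.
From mathcomp Require Import all_boot all_order all_algebra.
From mathcomp Require Import all_classical all_reals all_analysis.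
From mathcomp Require Import complex ring lra.

Set Implicit Arguments.
Unset Strict Implicit.
Unset Printing Implicit Defensive.

Import Order.TTheory GRing.Theory Num.Theory.
Import numFieldNormedType.Exports.

Local Open Scope classical_set_scope.
Local Open Scope ring_scope.
Local Open Scope complex_scope.

(** Formally, [A] off-diagonal and [diag(B, C)] diagonal on [H + H] are two
    self-adjoint operators whose exponentials commute; the claim is that the
    operators themselves commute. The proof replaces the functional calculus
    of the logarithm by repeated square roots.

    Positive square roots are unique in the following strong sense: if [P] and
    [Q] are positive, [Q] bounded below, and [S Q^2 = P^2 S], then
    [S Q = P S] ([sqrt_intertwine]). Indeed [Y = S Q - P S] solves the
    Sylvester equation [P Y = - Y Q], and comparing [P + t] with [t - Q] for a
    large real [t] forces [Y = 0] ([sylvester_eq0]).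

    Since [e^T] is the square of the positive operator [e^(T/2)], a relation
    [S e^C = e^B S] descends to [S e^(C/2^n) = e^(B/2^n) S] for all [n], and
    [2^n (e^(T/2^n) - 1)] tends to [T], so [S C = B S] ([exp_intertwine]). Hence
    [cosh A] commutes with [B] and with [C], and [sinh A C = B sinh A].

    It remains to pass from the hyperbolic functions of [A] to [A]. As
    [cosh T + 1 = 2 cosh(T/2)^2] and [cosh(T/2) >= 1], commutation with
    [cosh T] descends to [cosh(T/2)]; as [sinh T = 2 sinh(T/2) cosh(T/2)],
    cancelling the injective factor [cosh(T/2)] brings the relation for [sinh]
    down to [T/2] as well. Thus [sinh(A/2^n) C = B sinh(A/2^n)] for all [n], and
    [2^n sinh(A/2^n)] tends to [A].

    The addition law of the operator exponential, and the first-order estimate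
    of [e^T - 1 - T], are obtained by dominating the operator series by the
    corresponding real ones at the operator norm. *)

(** * Operator norm and norm limits *)

Section OperatorNorm.
Context {R : realType} {H : hilbertType R}.
Implicit Types (x y : H) (S T U V : boundedOp H).

Lemma opnormD S T : opnorm (S + T) <= opnorm S + opnorm T.
Proof. by rewrite -lecR rmorphD/=; exact: opnormC_triangle. Qed.

Lemma opnormZ (a : R) T : opnorm (a%:C *: T) = `|a| * opnorm T.
Proof.
apply: complexI; rewrite -op_normE normrZ op_normE rmorphM/=; congr (_ * _).
by rewrite -[`|a%:C|]/((Normc.normc a%:C)%:C) /= expr0n addr0 sqrtr_sqr.
Qed.

Lemma opnormN T : opnorm (- T) = opnorm T.
Proof. by apply: complexI; rewrite -!op_normE normrN. Qed.

Lemma opnorm_eq0 T : opnorm T <= 0 -> T = 0.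
Proof.
move=> T0; apply: opnormC_eq0; congr (_%:C).
by apply/eqP; rewrite eq_le T0 opnorm_ge0.
Qed.

Lemma opnorm_sum I (r : seq I) (P : pred I) (F : I -> boundedOp H) :
  opnorm (\sum_(i <- r | P i) F i) <= \sum_(i <- r | P i) opnorm (F i).
Proof.
elim/big_ind2 : _ => [|S s T t Ss Tt|//].
  by apply: opnorm_le => // x; rewrite op_zeroE rnorm0 mul0r.
by rewrite (le_trans (opnormD _ _))// lerD.
Qed.

Lemma op_scaleMl (a : R[i]) S T : (a *: S) * T = a *: (S * T).
Proof. exact/op_eqP. Qed.

Lemma op_scaleMr (a : R[i]) S T : S * (a *: T) = a *: (S * T).
Proof. by apply/op_eqP => x; exact: linearZ. Qed.

(** Convergence in the normed space of operators, read on real-valued norms. *)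
Lemma op_cvgP (u : nat -> boundedOp H) U :
  u @ \oo --> U <-> opnorm (U - u n) @[n --> \oo] --> (0 : R).
Proof.
split => [/cvgrPdist_le uU|/cvgrPdist_le uU].
  apply/cvgrPdist_le => e e0.
  have /uU : 0 < e%:C :> R[i] by rewrite ltcR.
  apply: filterS => n; rewrite op_normE lecR sub0r normrN ger0_norm//.
  exact: opnorm_ge0.
apply/cvgrPdist_le => e e0.
have [r r0 <-] : exists2 r : R, 0 < r & r%:C = e.
  by move: e0; case: e => a b; rewrite ltcE/= => /andP[/eqP-> a0]; exists a.
apply: filterS (uU r r0) => n; rewrite op_normE lecR sub0r normrN ger0_norm//.
exact: opnorm_ge0.
Qed.

Lemma op_cvg_unique (u : nat -> boundedOp H) U V :
  u @ \oo --> U -> u @ \oo --> V -> U = V.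
Proof. by apply: cvg_unique; exact: norm_hausdorff. Qed.

Lemma op_cvgM (u v : nat -> boundedOp H) U V :
  u @ \oo --> U -> v @ \oo --> V -> (fun n => u n * v n) @ \oo --> U * V.
Proof.
move=> /op_cvgP uU /op_cvgP vV; apply/op_cvgP.
have cvg_bound : opnorm U * opnorm (V - v n) +
    opnorm (U - u n) * (opnorm V + opnorm (V - v n)) @[n --> \oo] --> (0 : R).
  rewrite -[0](_ : opnorm U * 0 + 0 * (opnorm V + 0) = 0); last first.
    by rewrite mulr0 mul0r addr0.
  apply: cvgD; first exact: cvgMr.
  by apply: cvgM => //; apply: cvgD => //; exact: cvg_cst.
apply: squeeze_cvgr (cvg_cst (0 : R)) cvg_bound.
near=> n; rewrite opnorm_ge0/=.
have -> : U * V - u n * v n = U * (V - v n) + (U - u n) * v n.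
  by rewrite mulrBr mulrBl addrA subrK.
rewrite (le_trans (opnormD _ _))// lerD ?opnormM//.
rewrite (le_trans (opnormM _ _))// ler_wpM2l ?opnorm_ge0//.
by rewrite -{1}(subKr V (v n)) (le_trans (opnormD _ _))// opnormN.
Unshelve. all: by end_near. Qed.

Lemma op_cvg_opnorm_le (u : nat -> boundedOp H) (v : nat -> R) U (M : R) :
  u @ \oo --> U -> v @ \oo --> M -> (forall n, opnorm (u n) <= v n) ->
  opnorm U <= M.
Proof.
move=> /op_cvgP uU vM uv.
have cvg_bound : opnorm (U - u n) + v n @[n --> \oo] --> M.
  by rewrite -[M]add0r; exact: cvgD.
apply: (ler_cvg_to (cvg_cst (opnorm U)) cvg_bound).
near=> n; rewrite -{1}(subrK (u n) U) (le_trans (opnormD _ _))//.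
by rewrite lerD2l.
Unshelve. all: by end_near. Qed.

End OperatorNorm.

(** * The exponential and hyperbolic functions of an operator *)

(** The part of the [n] by [n] square lying beyond the [n]-th antidiagonal:
    what separates a product of two partial sums from the partial sum of
    their Cauchy product. *)
Lemma square_sub_triangle (V : zmodType) (x : nat -> nat -> V) (n : nat) :
  \sum_(i < n) \sum_(j < n) x i j - \sum_(k < n) \sum_(i < k.+1) x i (k - i)%N =
  \sum_(i < n) \sum_(j < n | (n <= i + j)%N) x i j.
Proof.
have -> : \sum_(k < n) \sum_(i < k.+1) x i (k - i)%N =
    \sum_(i < n) \sum_(j < n | ~~ (n <= i + j)%N) x i j.
  under eq_bigr => k _ do
    rewrite (big_ord_widen n (fun i => x i (k - i)%N) (ltn_ord k)).
  rewrite (exchange_big_dep xpredT)//=; apply: eq_bigr => i _.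
  rewrite -(big_mkord (fun k => (i < k.+1)%N) (fun k => x i (k - i)%N)).
  rewrite -(big_mkord (fun j => ~~ (n <= i + j)%N) (fun j => x i j)).
  rewrite (@big_cat_nat _ _ _ i)//=; last exact/ltnW.
  rewrite big_nat_cond big_pred0 ?add0r; last first.
    by move=> k; rewrite ltnS; case: leqP; rewrite ?andbT ?andbF.
  rewrite -{1}(add0n i) big_addn.
  have -> : \sum_(0 <= j < n - i | (i < (j + i).+1)%N) x i (j + i - i)%N =
            \sum_(0 <= j < n - i) x i j.
    by apply: eq_big => [j|j _]; rewrite ?addnK// ltnS leq_addl.
  rewrite [LHS](big_nat_widen _ _ n) ?leq_subr//; apply: eq_bigl => j /=.
  by rewrite -ltnNge ltn_subRL.
rewrite -sumrB; apply: eq_bigr => i _.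
by rewrite (bigID (fun j : 'I_n => (n <= i + j)%N))/= addrK.
Qed.

Section OperatorExponential.
Context {R : realType} {H : hilbertType R}.
Implicit Types (x y : H) (S T U V : boundedOp H).

(** General term of the exponential series. *)
Definition op_exp_term T n : boundedOp H := n`!%:R^-1 *: T ^+ n.

Lemma op_exp_cvg T : series (op_exp_term T) @ \oo --> op_exp T.
Proof. exact: is_cvg_op_exp. Qed.

Lemma expR_cvg (t : R) : series (exp_coeff t) @ \oo --> expR t.
Proof. exact: is_cvg_series_exp_coeff. Qed.

Lemma inv_fact_bin (F : numFieldType) k i : (i <= k)%N ->
  k`!%:R^-1 *+ 'C(k, i) = i`!%:R^-1 * (k - i)%N`!%:R^-1 :> F.
Proof.
move=> ik; have fact_neq0 m : m`!%:R != 0 :> F.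
  by rewrite pnatr_eq0 -lt0n fact_gt0.
rewrite -(bin_fact ik) !natrM !invfM -mulrnAl.
by rewrite -mulr_natr mulVf ?mul1r// pnatr_eq0 -lt0n bin_gt0.
Qed.

Lemma op_exp_termD S T k : S * T = T * S ->
  op_exp_term (S + T) k =
  \sum_(i < k.+1) op_exp_term S i * op_exp_term T (k - i)%N.
Proof.
move=> ST; rewrite /op_exp_term addrC (exprDn_comm _ (esym ST)) scaler_sumr.
apply: eq_bigr => i _; have ik : (i <= k)%N by rewrite -ltnS.
rewrite op_scaleMl op_scaleMr scalerA -inv_fact_bin// -scalerMnr scalerMnl.
congr (_ *: _).
by apply: commrX; apply: commr_sym; apply: commrX.
Qed.

Lemma exp_coeffD (s t : R) k :
  exp_coeff (s + t) k = \sum_(i < k.+1) exp_coeff s i * exp_coeff t (k - i)%N.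
Proof.
rewrite /exp_coeff/= addrC exprDn mulr_suml; apply: eq_bigr => i _.
have ik : (i <= k)%N by rewrite -ltnS.
by rewrite mulrACA -inv_fact_bin// mulrnAl mulrnAr [t ^+ _ * _]mulrC.
Qed.

(** The defect of multiplicativity of the partial sums is a sum of products
    of terms, hence bounded by the same defect for the real exponential at the
    norms of [S] and [T], which vanishes in the limit. *)
Lemma op_expD S T : S * T = T * S -> op_exp (S + T) = op_exp S * op_exp T.
Proof.
move=> ST; set s := opnorm S; set t := opnorm T.
have dom n : opnorm (series (op_exp_term S) n * series (op_exp_term T) n -
    series (op_exp_term (S + T)) n) <=
  series (exp_coeff s) n * series (exp_coeff t) n -
    series (exp_coeff (s + t)) n.
  rewrite /series/= !big_mkord.
  under [X in opnorm (_ - X)]eq_bigr do rewrite op_exp_termD//.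
  under [X in _ <= _ - X]eq_bigr do rewrite exp_coeffD.
  rewrite !big_distrlr/=.
  rewrite (square_sub_triangle (fun i j => op_exp_term S i * op_exp_term T j)).
  rewrite (square_sub_triangle (fun i j => exp_coeff s i * exp_coeff t j)).
  rewrite (le_trans (opnorm_sum _ _ _))// ler_sum// => i _.
  rewrite (le_trans (opnorm_sum _ _ _))// ler_sum// => j _.
  by rewrite (le_trans (opnormM _ _))// ler_pM ?opnorm_ge0 ?opnorm_coeff.
apply/esym/subr0_eq/opnorm_eq0; rewrite -[leRHS](subrr (expR (s + t))) {1}expRD.
apply: op_cvg_opnorm_le dom; apply: cvgB; try exact: op_exp_cvg.
- by apply: op_cvgM; exact: op_exp_cvg.
- by apply: cvgM; exact: expR_cvg.
- exact: expR_cvg.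
Qed.

Lemma op_exp0 : op_exp (0 : boundedOp H) = 1.
Proof.
apply: (op_cvg_unique (@op_exp_cvg 0)).
apply: cvg_near_cst; near=> n.
have n0 : (0 < n)%N by near: n; exists 1%N.
rewrite /series/= -(prednK n0) big_nat_recl// big1 ?addr0.
  by rewrite /op_exp_term expr0 invr1 scale1r.
by move=> i _; rewrite /op_exp_term exprS mul0r scaler0.
Unshelve. all: by end_near. Qed.

Lemma op_expNl T : op_exp (- T) * op_exp T = 1.
Proof. by rewrite -op_expD ?addNr ?op_exp0// mulrN mulNr. Qed.

Lemma op_expNr T : op_exp T * op_exp (- T) = 1.
Proof. by rewrite -op_expD ?addrN ?op_exp0// mulrN mulNr. Qed.

Lemma scale_half T : 2^-1%:C *: T + 2^-1%:C *: T = T.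
Proof.
rewrite -scalerDl -rmorphD/=.
have -> : 2^-1 + 2^-1 = 1 :> R by lra.
by rewrite scale1r.
Qed.

Lemma op_exp_half T : op_exp T = op_exp (2^-1%:C *: T) * op_exp (2^-1%:C *: T).
Proof. by rewrite -op_expD// scale_half. Qed.

(** First-order Taylor remainder, bounded by that of the scalar exponential
    at the norm. *)
Lemma opnorm_exp_sub1 T : opnorm T <= 2^-1 ->
  opnorm (op_exp T - (1 + T)) <= 2 * opnorm T ^+ 2.
Proof.
set t := opnorm T => t_le.
have t0 : 0 <= t := opnorm_ge0 T.
have cvg_op : (fun n => series (op_exp_term T) (n + 2)%N - (1 + T)) @ \oo -->
    op_exp T - (1 + T).
  apply: cvgB; last exact: cvg_cst.
  by apply: cvg_comp (@op_exp_cvg T); exact: cvg_addnr.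
have cvg_R : (fun n => series (exp_coeff t) (n + 2)%N - (1 + t)) @ \oo -->
    expR t - (1 + t).
  apply: cvgB; last exact: cvg_cst.
  by apply: cvg_comp (@expR_cvg t); exact: cvg_addnr.
apply: (@le_trans _ _ (expR t - (1 + t))).
  apply: op_cvg_opnorm_le cvg_op cvg_R _ => n.
  rewrite addn2 /series/= !big_nat_recl//.
  rewrite /op_exp_term /exp_coeff/= !invr1 !scale1r !expr0 !expr1 ?mulr1.
  rewrite !addrA [X in opnorm X]addrC addKr [leRHS]addrC addKr.
  rewrite (le_trans (opnorm_sum _ _ _))// ler_sum// => i _.
  exact: opnorm_coeff.
(* [1 - t <= expR (- t)] gives [expR t <= 1 / (1 - t)], and
   [1 / (1 - t) - 1 - t = t ^+ 2 / (1 - t)], where [1 - t >= 1 / 2]. *)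
have expN : 1 - t <= expR (- t) by rewrite expR_ge1Dx.
have expK : expR t * expR (- t) = 1 by rewrite -expRD subrr expR0.
have exp0 : 0 <= expR t by exact: expR_ge0.
by nra.
Qed.

Lemma op_exp_cosh_sinh T : op_exp T = op_cosh T + op_sinh T.
Proof.
have cvg2 : (fun n => series (op_exp_term T) (2 * n)%N) @ \oo --> op_exp T.
  by apply: cvg_comp (@op_exp_cvg T); exact: cvg_mulnl.
apply: op_cvg_unique cvg2 _.
suff -> : (fun n => series (op_exp_term T) (2 * n)%N) =
    series (fun n => (2 * n)`!%:R^-1 *: T ^+ (2 * n)) +
    series (fun n => (2 * n).+1`!%:R^-1 *: T ^+ (2 * n).+1).
  by apply: cvgD; [exact: is_cvg_op_cosh|exact: is_cvg_op_sinh].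
apply/funext => n; rewrite /series/= fctE.
elim: n => [|n ih]; first by rewrite !big_geq ?addr0.
by rewrite mulnS !big_nat_recr//= addrACA -ih addrA.
Qed.

Lemma op_coshN T : op_cosh (- T) = op_cosh T.
Proof.
rewrite /op_cosh; congr (limn (series _)); apply/funext => n.
by rewrite !exprM sqrrN.
Qed.

Lemma op_sinhN T : op_sinh (- T) = - op_sinh T.
Proof.
apply: (@op_cvg_unique _ _
  (series (fun n => (2 * n).+1`!%:R^-1 *: (- T) ^+ (2 * n).+1))).
  exact: is_cvg_op_sinh.
suff -> : series (fun n => (2 * n).+1`!%:R^-1 *: (- T) ^+ (2 * n).+1) =
    - series (fun n => (2 * n).+1`!%:R^-1 *: T ^+ (2 * n).+1).
  by apply: cvgN; exact: is_cvg_op_sinh.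
apply/funext => n; rewrite /series/= fctE -sumrN.
by apply: eq_bigr => i _; rewrite !exprS !exprM sqrrN mulNr scalerN.
Qed.

Lemma op_coshE T : op_cosh T = 2^-1%:C *: (op_exp T + op_exp (- T)).
Proof.
rewrite !op_exp_cosh_sinh op_coshN op_sinhN addrACA subrr addr0.
by rewrite scalerDr scale_half.
Qed.

Lemma op_sinhE T : op_sinh T = 2^-1%:C *: (op_exp T - op_exp (- T)).
Proof.
rewrite !op_exp_cosh_sinh op_coshN op_sinhN opprD opprK addrACA subrr add0r.
by rewrite scalerDr scale_half.
Qed.

End OperatorExponential.

(** * Self-adjoint and positive operators *)

Section RealInnerProduct.
Context {R : realType} {H : hilbertType R}.
Implicit Types (x y z : H) (S T U P : boundedOp H).

(** The real part of the inner product: a real symmetric bilinear form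
    inducing the same norm. *)
Definition rinner x y : R := complex.Re (inner x y).

Lemma rinner_sym x y : rinner x y = rinner y x.
Proof.
rewrite /rinner (hermC (@inner R H)) expr0 mul1r.
have Re_conj (z : R[i]) : complex.Re (Num.conj z) = complex.Re z by case: z.
exact: Re_conj.
Qed.

Lemma rinnerDl x y z : rinner (x + y) z = rinner x z + rinner y z.
Proof. by rewrite /rinner linearDl raddfD. Qed.

Lemma rinnerDr x y z : rinner x (y + z) = rinner x y + rinner x z.
Proof. by rewrite rinner_sym rinnerDl !(rinner_sym x). Qed.

Lemma rinnerZl (a : R) x y : rinner (a%:C *: x) y = a * rinner x y.
Proof.
rewrite /rinner linearZl_LR /=.
by case: (inner x y) => b c /=; rewrite mul0r subr0.
Qed.

Lemma rinnerZr (a : R) x y : rinner x (a%:C *: y) = a * rinner x y.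
Proof. by rewrite rinner_sym rinnerZl rinner_sym. Qed.

Lemma rinnerNl x y : rinner (- x) y = - rinner x y.
Proof. by rewrite /rinner linearNl raddfN. Qed.

Lemma rinnerNr x y : rinner x (- y) = - rinner x y.
Proof. by rewrite rinner_sym rinnerNl rinner_sym. Qed.

Lemma rinnerE x : rinner x x = rnorm x ^+ 2.
Proof. by rewrite /rinner innerE rnormE -rmorphXn. Qed.

Lemma rnormN x : rnorm (- x) = rnorm x.
Proof. by rewrite /rnorm normrN. Qed.

(** Cauchy-Schwarz for the real part; it follows from the triangle
    inequality by squaring. *)
Lemma rinner_le x y : `|rinner x y| <= rnorm x * rnorm y.
Proof.
have le_rinner u v : rinner u v <= rnorm u * rnorm v.
  have := rnormD u v; have := rinnerE (u + v).
  rewrite rinnerDl !rinnerDr (rinner_sym v) !rinnerE => E D.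
  have : rnorm (u + v) ^+ 2 <= (rnorm u + rnorm v) ^+ 2.
    by rewrite lerXn2r ?nnegrE ?addr_ge0 ?rnorm_ge0.
  by rewrite -E sqrrD; lra.
rewrite ler_norml le_rinner andbT -(rnormN x) lerNl -rinnerNl.
exact: le_rinner.
Qed.

(** Symmetry with respect to the real part of the inner product, implied by
    self-adjointness. *)
Definition rselfadjoint T := forall x y, rinner (T x) y = rinner x (T y).

Lemma selfadjoint_rselfadjoint T : selfadjoint T -> rselfadjoint T.
Proof. by move=> sT x y; rewrite /rinner sT. Qed.

Lemma rselfadjointD S T :
  rselfadjoint S -> rselfadjoint T -> rselfadjoint (S + T).
Proof. by move=> sS sT x y; rewrite !op_addE rinnerDl rinnerDr sS sT. Qed.

Lemma rselfadjointN T : rselfadjoint T -> rselfadjoint (- T).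
Proof. by move=> sT x y; rewrite !op_oppE rinnerNl rinnerNr sT. Qed.

Lemma rselfadjointZ (a : R) T : rselfadjoint T -> rselfadjoint (a%:C *: T).
Proof. by move=> sT x y; rewrite !op_scaleE rinnerZl rinnerZr sT. Qed.

Lemma rselfadjointX T n : rselfadjoint T -> rselfadjoint (T ^+ n).
Proof.
move=> sT; elim: n => [|n ih] x y //.
by rewrite exprS; transitivity (rinner (T ((T ^+ n) x)) y);
  rewrite // sT ih -exprS exprSr.
Qed.

Lemma rselfadjoint_cvg (u : nat -> boundedOp H) U :
  u @ \oo --> U -> (forall n, rselfadjoint (u n)) -> rselfadjoint U.
Proof.
move=> /op_cvgP uU su x y; apply/eqP; rewrite -subr_eq0 -normr_le0.
set d := _ - _.
have d_le n : `|d| <= opnorm (U - u n) * (2 * rnorm x * rnorm y).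
  have -> : d = rinner ((U - u n) x) y - rinner x ((U - u n) y).
    rewrite !op_addE !op_oppE rinnerDl rinnerDr rinnerNl rinnerNr su /d.
    by ring.
  rewrite (le_trans (ler_normB _ _))//.
  rewrite (le_trans (lerD (rinner_le _ _) (rinner_le _ _)))//.
  have := opnormP (U - u n) x; have := opnormP (U - u n) y.
  move: (opnorm_ge0 (U - u n)) (rnorm_ge0 x) (rnorm_ge0 y).
  set o := opnorm _; set a := rnorm x; set b := rnorm y.
  move=> o0 a0 b0 hb ha.
  have -> : o * (2 * a * b) = (o * a) * b + a * (o * b) by ring.
  by rewrite lerD ?ler_wpM2r ?ler_wpM2l.
have cvg_bound :
    opnorm (U - u n) * (2 * rnorm x * rnorm y) @[n --> \oo] --> (0 : R).
  by rewrite -[0](mul0r (2 * rnorm x * rnorm y)); apply: cvgMl.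
by apply: (ler_cvg_to (cvg_cst `|d|) cvg_bound); near=> n.
Unshelve. all: by end_near. Qed.

Lemma rselfadjoint_exp T : rselfadjoint T -> rselfadjoint (op_exp T).
Proof.
move=> sT; apply: rselfadjoint_cvg (@op_exp_cvg _ _ T) _ => n.
rewrite /series/=; elim/big_ind : _ => [x y||i _].
- rewrite !op_zeroE -[0](scale0r (0 : H)) -[0 : R[i]]/(0%:C).
  by rewrite rinnerZl rinnerZr !mul0r.
- by move=> *; exact: rselfadjointD.
rewrite /op_exp_term; have -> : i`!%:R^-1 = (i`!%:R^-1)%:C :> R[i].
  by rewrite fmorphV/= rmorph_nat.
exact/rselfadjointZ/rselfadjointX.
Qed.

(** [P] is self-adjoint with [P >= c]. For [c = 0] this says that [P] is
    positive. *)
Definition coercive (c : R) P :=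
  rselfadjoint P /\ forall x, c * rnorm x ^+ 2 <= rinner (P x) x.

Lemma rnorm_shift2 (t : R) P x :
  rnorm (P x + t%:C *: x) ^+ 2 =
  rnorm (P x) ^+ 2 + 2 * t * rinner (P x) x + t ^+ 2 * rnorm x ^+ 2.
Proof.
rewrite -!rinnerE rinnerDl !rinnerDr !rinnerZl !rinnerZr (rinner_sym x).
by ring.
Qed.

(** The Sylvester equation [P * Y + Y * Q = 0] with positive [P] and strictly
    positive [Q] has only the zero solution: for large [t], [P + t] expands
    by at least [t] whereas [t - Q] contracts strictly below [t]. *)
Lemma sylvester_eq0 (c : R) P Q Y : 0 < c -> coercive 0 P -> coercive c Q ->
  P * Y = - (Y * Q) -> Y = 0.
Proof.
move=> c0 [sP cP] [sQ cQ] PY.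
(* [t] is chosen so that [2 * t * c - n ^+ 2 >= 1], which bounds the square of
   the norm of [t - Q] by [t ^+ 2 - 1]. *)
pose n := opnorm Q; pose t := (n ^+ 2 + 1) / c + 1; pose y := opnorm Y.
have n0 : 0 <= n := opnorm_ge0 Q.
have y0 : 0 <= y := opnorm_ge0 Y.
have t1 : 1 <= t by rewrite lerDr divr_ge0 ?addr_ge0 ?sqr_ge0 ?ler01// ltW.
have tc : n ^+ 2 + 1 <= t * c.
  by rewrite mulrDl mul1r -mulrA mulVf ?gt_eqF// mulr1 lerDl ltW.
pose q := Num.sqrt ((t ^+ 2 - 1) / t ^+ 2).
have t2 : 0 < t ^+ 2 by nra.
have q2 : q ^+ 2 = (t ^+ 2 - 1) / t ^+ 2.
  by rewrite sqr_sqrtr// divr_ge0 ?subr_ge0 ?(ltW t2)//; nra.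
have q1 : q < 1.
  by rewrite -sqrtr1 ltr_sqrt// ltr_pdivrMr// mul1r ltrBlDr ltrDl.
have q0 : 0 <= q := sqrtr_ge0 _.
(* The operator norm of [Y] shrinks by the factor [q < 1]. *)
suff : y <= q * y by move=> yq; apply: opnorm_eq0; rewrite -/y; nra.
apply: opnorm_le => [|x]; first exact: mulr_ge0.
rewrite -(@ler_pXn2r _ 2) ?nnegrE ?mulr_ge0 ?rnorm_ge0//.
rewrite -(ler_pM2l t2) !exprMn q2.
have -> : t ^+ 2 * ((t ^+ 2 - 1) / t ^+ 2 * y ^+ 2 * rnorm x ^+ 2) =
    y ^+ 2 * ((t ^+ 2 - 1) * rnorm x ^+ 2) by field; rewrite gt_eqF//; nra.
have expand : t ^+ 2 * rnorm (Y x) ^+ 2 <= rnorm (P (Y x) + t%:C *: Y x) ^+ 2.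
  rewrite rnorm_shift2 lerDr addr_ge0 ?sqr_ge0// !mulr_ge0//; first lra.
  by rewrite (le_trans _ (cP _))// mul0r.
have contract : rnorm (Q x + (- t)%:C *: x) ^+ 2 <= (t ^+ 2 - 1) * rnorm x ^+ 2.
  have Qx2 : rnorm (Q x) ^+ 2 <= n ^+ 2 * rnorm x ^+ 2.
    by rewrite -exprMn lerXn2r ?nnegrE ?mulr_ge0 ?rnorm_ge0// opnormP.
  have := cQ x; rewrite rnorm_shift2.
  move: Qx2; set r := rnorm x ^+ 2; set p := rinner _ _; set w := rnorm _ ^+ 2.
  have r0 : 0 <= r by exact: sqr_ge0.
  move=> Qx2 cp.
  have : t * (c * r) <= t * p by rewrite ler_wpM2l//; lra.
  have : (n ^+ 2 + 1) * r <= t * c * r by rewrite ler_wpM2r.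
  by nra.
have PYx : P (Y x) + t%:C *: Y x = - Y (Q x + (- t)%:C *: x).
  have /op_eqP/(_ x) : P * Y = - (Y * Q) by [].
  rewrite -[(P * Y) x]/(P (Y x)) -[(- (Y * Q)) x]/(- Y (Q x)) => ->.
  by rewrite linearD linearZ/= rmorphN scaleNr opprB addrC.
rewrite (le_trans expand)// PYx rnormN.
rewrite (le_trans _ (ler_wpM2l (sqr_ge0 y) contract))// -exprMn.
by rewrite lerXn2r ?nnegrE ?mulr_ge0 ?rnorm_ge0// opnormP.
Qed.

(** Intertwining passes to positive square roots. *)
Lemma sqrt_intertwine (c : R) P Q S : 0 < c -> coercive 0 P -> coercive c Q ->
  S * (Q * Q) = P * P * S -> S * Q = P * S.
Proof.
move=> c0 cP cQ SQ; apply: subr0_eq; apply: sylvester_eq0 c0 cP cQ _.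
by rewrite mulrBl mulrBr -!mulrA SQ opprB !mulrA.
Qed.

Lemma coercive_sqr T (c : R) : rselfadjoint T ->
  (forall x, c * rnorm x ^+ 2 <= rnorm (T x) ^+ 2) -> coercive c (T * T).
Proof.
move=> sT cT; split=> [x y|x]; last by rewrite sT rinnerE.
by rewrite -[(T * T) x]/(T (T x)) !sT.
Qed.

(** [e^T] is the square of [e^(T/2)], which is bounded below because it has
    the bounded inverse [e^(-T/2)]. *)
Lemma coercive_exp T : rselfadjoint T ->
  exists2 c : R, 0 < c & coercive c (op_exp T).
Proof.
move=> sT; pose Z := op_exp (2^-1%:C *: T); pose W := op_exp (- (2^-1%:C *: T)).
(* The added [1] keeps [K] positive when [H] is trivial. *)
pose K := opnorm W + 1.
have K0 : 0 < K by rewrite ltr_wpDl ?opnorm_ge0.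
exists (K ^-2); first by rewrite invr_gt0 exprn_gt0.
rewrite op_exp_half; apply: coercive_sqr => [|x].
  exact/rselfadjoint_exp/rselfadjointZ.
rewrite -/Z ler_pdivrMl ?exprn_gt0// -exprMn.
rewrite lerXn2r ?nnegrE ?mulr_ge0 ?rnorm_ge0//.
  exact: ltW.
have {1}-> : x = W (Z x).
  have /op_eqP/(_ x) : W * Z = 1 by exact: op_expNl.
  by move=> /esym.
rewrite (le_trans (opnormP _ _))// ler_wpM2r ?rnorm_ge0//.
by rewrite lerDl.
Qed.

End RealInnerProduct.

(** * Double-angle formulas *)

Section Hyperbolic.
Context {R : realType} {H : hilbertType R}.
Implicit Types (x : H) (S T P Q : boundedOp H).

Lemma rselfadjoint_cosh T : rselfadjoint T -> rselfadjoint (op_cosh T).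
Proof.
move=> sT; rewrite op_coshE; apply: rselfadjointZ.
by apply: rselfadjointD; apply: rselfadjoint_exp => //; exact: rselfadjointN.
Qed.

Lemma rselfadjoint_sinh T : rselfadjoint T -> rselfadjoint (op_sinh T).
Proof.
move=> sT; rewrite op_sinhE; apply: rselfadjointZ.
apply: rselfadjointD; first exact: rselfadjoint_exp.
by apply/rselfadjointN/rselfadjoint_exp/rselfadjointN.
Qed.

Lemma op_cosh_double T :
  op_cosh (T + T) + 1 = 2%:C *: (op_cosh T * op_cosh T).
Proof.
rewrite !op_coshE opprD !op_expD//.
set w := op_exp T; set v := op_exp (- T).
rewrite op_scaleMl op_scaleMr !scalerA mulrDl !mulrDr [w * v]op_expNr.
rewrite [v * w]op_expNl [1 + v * v]addrC addrACA -!rmorphM/= mulrA mulfV//.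
by rewrite mul1r [RHS]scalerDr; congr (_ + _); rewrite scalerDr scale_half.
Qed.

Lemma op_sinh_double T : op_sinh (T + T) = 2%:C *: (op_sinh T * op_cosh T).
Proof.
rewrite !op_coshE !op_sinhE opprD !op_expD//.
set w := op_exp T; set v := op_exp (- T).
rewrite op_scaleMl op_scaleMr !scalerA mulrBl !mulrDr [w * v]op_expNr.
rewrite [v * w]op_expNl opprD addrA -[_ + 1 - 1]addrA subrr addr0.
by rewrite -!rmorphM/= mulrA mulfV// mul1r.
Qed.

Lemma op_cosh_double_sinh T :
  op_cosh (T + T) = 1 + 2%:C *: (op_sinh T * op_sinh T).
Proof.
rewrite op_sinhE op_coshE opprD !op_expD//.
set w := op_exp T; set v := op_exp (- T).
rewrite op_scaleMl op_scaleMr !scalerA mulrBl !mulrBr [w * v]op_expNr.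
rewrite [v * w]op_expNl -!rmorphM/= mulrA mulfV// mul1r.
rewrite -{1}(scale_half 1) -!scalerDr; congr (_ *: _).
by rewrite opprB [w * w - 1 + _]addrACA -opprD [RHS]addrC subrK.
Qed.

Lemma coercive_cosh T : rselfadjoint T -> coercive 1 (op_cosh T).
Proof.
move=> sT; split=> [|x]; first exact: rselfadjoint_cosh.
pose S := op_sinh (2^-1%:C *: T).
have sS : rselfadjoint S.
  exact/rselfadjoint_sinh/rselfadjointZ.
rewrite -{1}(scale_half T) op_cosh_double_sinh op_addE op_scaleE.
rewrite rinnerDl rinnerZl.
rewrite -/S -[(S * S) x]/(S (S x)) sS !rinnerE mul1r lerDl.
by rewrite mulr_ge0 ?sqr_ge0.
Qed.

Lemma coercive0 : coercive (0 : R) (0 : boundedOp H).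
Proof.
have rinner0 x y : rinner (0 : H) y = 0 :> R.
  by rewrite -(scale0r x) -[0 : R[i]]/(0%:C) rinnerZl mul0r.
by split=> [x y|x]; rewrite !op_zeroE ?(rinner_sym x) !rinner0 ?mul0r.
Qed.

Lemma coercive_le (c d : R) P : c <= d -> coercive d P -> coercive c P.
Proof.
move=> cd [sP dP]; split=> // x.
by rewrite (le_trans _ (dP x))// ler_wpM2r ?sqr_ge0.
Qed.

End Hyperbolic.

(** * Descent by halving *)

Section Dyadic.
Context {R : realType} {H : hilbertType R}.
Implicit Types (S T A B C : boundedOp H).

(** The operator [T / 2^n]. *)
Definition dyadic T n := (2^-1 ^+ n)%:C *: T.

Lemma dyadic0 T : dyadic T 0 = T.
Proof. by rewrite /dyadic expr0 scale1r. Qed.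

Lemma dyadicS T n : dyadic T n.+1 = 2^-1%:C *: dyadic T n.
Proof. by rewrite /dyadic scalerA -rmorphM/= exprS. Qed.

Lemma dyadic_double T n : dyadic T n = dyadic T n.+1 + dyadic T n.+1.
Proof. by rewrite dyadicS scale_half. Qed.

Lemma dyadicN T n : dyadic (- T) n = - dyadic T n.
Proof. by rewrite /dyadic scalerN. Qed.

Lemma rselfadjoint_dyadic T n : rselfadjoint T -> rselfadjoint (dyadic T n).
Proof. exact: rselfadjointZ. Qed.

Lemma op_exp_dyadic_cvg T :
  (fun n => (2 ^+ n)%:C *: (op_exp (dyadic T n) - 1)) @ \oo --> T.
Proof.
apply/op_cvgP; set t := opnorm T.
have half_cvg : 2^-1 ^+ n @[n --> \oo] --> (0 : R).
  by apply: cvg_expr; rewrite ger0_norm ?invr_ge0// invf_lt1// ltr1n.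
have small : \forall n \near \oo, 2^-1 ^+ n * t <= 2^-1.
  have : 2^-1 ^+ n * t @[n --> \oo] --> (0 : R).
    by rewrite -[0](mul0r t); exact: cvgMl.
  move=> /cvgrPdist_le/(_ 2^-1); rewrite invr_gt0 => /(_ (ltr0n _ 2)).
  by apply: filterS => n; rewrite sub0r normrN; apply: le_trans; exact: ler_norm.
have cvg_bound : 2^-1 ^+ n * (2 * t ^+ 2) @[n --> \oo] --> (0 : R).
  by rewrite -[0](mul0r (2 * t ^+ 2)); exact: cvgMl.
apply: squeeze_cvgr (cvg_cst (0 : R)) cvg_bound.
near=> n; rewrite opnorm_ge0/=.
have pow1 : 2 ^+ n * 2^-1 ^+ n = 1 :> R by rewrite -exprMn mulfV// expr1n.
have pow0 : 0 <= 2^-1 ^+ n :> R by rewrite exprn_ge0// invr_ge0.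
have nT : opnorm (dyadic T n) = 2^-1 ^+ n * t by rewrite opnormZ ger0_norm.
have -> : T - (2 ^+ n)%:C *: (op_exp (dyadic T n) - 1) =
    - ((2 ^+ n)%:C *: (op_exp (dyadic T n) - (1 + dyadic T n))).
  rewrite opprD addrA [X in _ = - X]scalerBr /dyadic scalerA -rmorphM/= pow1.
  by rewrite scale1r opprB.
rewrite opnormN opnormZ ger0_norm ?exprn_ge0//.
have small_n : opnorm (dyadic T n) <= 2^-1 by rewrite nT; near: n.
have pow2 : 0 <= 2 ^+ n :> R by rewrite exprn_ge0.
rewrite (le_trans (ler_wpM2l pow2 (opnorm_exp_sub1 small_n)))// nT.
rewrite [leLHS](_ : _ = (2 ^+ n * 2^-1 ^+ n) * (2^-1 ^+ n * (2 * t ^+ 2))).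
  by rewrite pow1 mul1r.
by ring.
Unshelve. all: by end_near. Qed.

Lemma op_sinh_dyadic_cvg T :
  (fun n => (2 ^+ n)%:C *: op_sinh (dyadic T n)) @ \oo --> T.
Proof.

set D := fun S n => (2 ^+ n)%:C *: (op_exp (dyadic S n) - 1).
have cvg_D S : D S @ \oo --> S by exact: op_exp_dyadic_cvg.
suff : (fun n => (2 ^+ n)%:C *: op_sinh (dyadic T n)) @ \oo -->
    2^-1%:C *: (T - - T) by rewrite opprK scalerDr scale_half.
rewrite [X in X @ _ --> _](_ : _ = fun n => 2^-1%:C *: (D T n - D (- T) n)).
  by apply: cvgZl_tmp; apply: cvgB; exact: cvg_D.
apply/funext => n; rewrite /D -scalerBr !scalerA op_sinhE scalerA dyadicN.
rewrite mulrC; congr (_ *: _).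
by rewrite opprB addrA subrK.
Qed.

(** An intertwining relation between exponentials of self-adjoint operators
    descends to the operators. *)
Lemma exp_intertwine S B C : rselfadjoint B -> rselfadjoint C ->
  S * op_exp C = op_exp B * S -> S * C = B * S.
Proof.
move=> sB sC SCB.
have SCBn n : S * op_exp (dyadic C n) = op_exp (dyadic B n) * S.
  elim: n => [|n ih]; first by rewrite !dyadic0.
  have [b b0 cB] := coercive_exp (@rselfadjoint_dyadic B n.+1 sB).
  have [c c0 cC] := coercive_exp (@rselfadjoint_dyadic C n.+1 sC).
  apply: sqrt_intertwine c0 (coercive_le (ltW b0) cB) cC _.
  by rewrite -!op_expD// -!dyadic_double.
apply: op_cvg_unique (op_cvgM (cvg_cst S) (@op_exp_dyadic_cvg C)) _.
rewrite [X in X @ _ --> _](_ : _ =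
    fun n => ((2 ^+ n)%:C *: (op_exp (dyadic B n) - 1)) * S).
  exact: op_cvgM (@op_exp_dyadic_cvg B) (cvg_cst S).
apply/funext => n.
by rewrite op_scaleMr op_scaleMl mulrBr mulrBl SCBn mulr1 mul1r.
Qed.

Lemma cosh_sqrt_commute S T : rselfadjoint T ->
  S * op_cosh (T + T) = op_cosh (T + T) * S -> S * op_cosh T = op_cosh T * S.
Proof.
move=> sT Sc; have cT := coercive_cosh sT.
apply: sqrt_intertwine ltr01 (coercive_le ler01 cT) cT _.
have : 2%:C *: (S * (op_cosh T * op_cosh T)) =
       2%:C *: (op_cosh T * op_cosh T * S).
  rewrite -op_scaleMr -[2%:C *: (_ * S)]op_scaleMl -op_cosh_double.
  by rewrite mulrDr mulrDl Sc mulr1 mul1r.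
by apply: scalerI; rewrite (_ : 0 = 0%:C)// eq_complex /= pnatr_eq0.
Qed.

Lemma sinh_half_intertwine T B C : rselfadjoint T ->
  C * op_cosh T = op_cosh T * C ->
  op_sinh (T + T) * C = B * op_sinh (T + T) -> op_sinh T * C = B * op_sinh T.
Proof.
move=> sT cC; rewrite op_sinh_double op_scaleMl op_scaleMr => sCB.
have {}sCB : op_sinh T * op_cosh T * C = B * (op_sinh T * op_cosh T).
  by apply: scalerI sCB; rewrite (_ : 0 = 0%:C)// eq_complex /= pnatr_eq0.
(* Right cancellation of [cosh T] is the Sylvester equation with [P = 0]. *)
apply: subr0_eq; apply: sylvester_eq0 ltr01 coercive0 (coercive_cosh sT) _.
by rewrite mul0r mulrBl -mulrA cC mulrA sCB !mulrA subrr oppr0.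
Qed.

End Dyadic.

Theorem theorem4 (R : realType) (H : hilbertType R) (sepH : separable H)
  (A B C : boundedOp H)
  (hA : selfadjoint A) (hB : selfadjoint B) (hC : selfadjoint C)
  (h1 : op_cosh A * op_exp B = op_exp B * op_cosh A)
  (h2 : op_sinh A * op_exp C = op_exp B * op_sinh A)
  (h3 : op_exp C * op_cosh A = op_cosh A * op_exp C)
  (h4 : op_exp C * op_sinh A = op_sinh A * op_exp B) :
  A * C = B * A.
Proof.
have sA := selfadjoint_rselfadjoint hA.
have sB := selfadjoint_rselfadjoint hB.
have sC := selfadjoint_rselfadjoint hC.
have descent n : [/\ B * op_cosh (dyadic A n) = op_cosh (dyadic A n) * B,
    C * op_cosh (dyadic A n) = op_cosh (dyadic A n) * C &
    op_sinh (dyadic A n) * C = B * op_sinh (dyadic A n)].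
  elim: n => [|n]; first by rewrite dyadic0; split; [exact/esym/exp_intertwine|
    exact/esym/exp_intertwine|exact: exp_intertwine].
  have sAn := @rselfadjoint_dyadic _ _ A n.+1 sA.
  rewrite dyadic_double => -[BA CA sCB].
  have CA' := cosh_sqrt_commute sAn CA.
  split=> //; first exact: cosh_sqrt_commute sAn BA.
  exact: sinh_half_intertwine sAn CA' sCB.
apply: op_cvg_unique (op_cvgM (@op_sinh_dyadic_cvg _ _ A) (cvg_cst C)) _.
rewrite [X in X @ _ --> _](_ : _ =
    fun n => B * ((2 ^+ n)%:C *: op_sinh (dyadic A n))).
  exact: op_cvgM (cvg_cst B) (@op_sinh_dyadic_cvg _ _ A).
apply/funext => n; have [_ _ sCB] := descent n.
by rewrite op_scaleMr op_scaleMl sCB.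
Qed.
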